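(* For every $m\ge1$, each of the sequences $\big(\#\Pi_n(1/2/\ldots/m)\big)_{n\ge0}$, $\big(\#\Pi_n(12\ldots m)\big)_{n\ge0}$ and $\big(\#\Pi_n(12/3/4/\ldots/m)\big)_{n\ge0}$ (the last for $m\ge2$) is P-recursive. Furthermore, for every partition $\pi$ of $[3]$, the sequence $\big(\#\Pi_n(\pi)\big)_{n\ge0}$ is P-recursive.
   Context: $\Pi_n$ is the set of partitions of $[n]=\{1,\ldots,n\}$, written with slashes between blocks. Standardization $\mathrm{st}$ is the order-preserving bijection of a finite integer set onto $[\#S]$. A subpartition of $\sigma$ is a partition each of whose blocks lies in a different block of $\sigma$; $\sigma$ contains $\pi$ if some subpartition $\sigma'$ has $\mathrm{st}(\sigma')=\pi$, else avoids $\pi$; $\Pi_n(\pi)$ is the set of $\sigma\in\Pi_n$ avoiding $\pi$. $1/2/\ldots/m$ is the all-singletons partition of $[m]$, $12\ldots m$ the one-block partition, $12/3/\ldots/m$ has blocks $\{1,2\},\{3\},\ldots,\{m\}$. A sequence $(a_n)$ is P-recursive if there are polynomials $P_0,\ldots,P_k$, not all zero, with $\sum_{i=0}^kP_i(n)a_{n+i}=0$ for all $n\ge0$. *)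

(* Defs.v *)
From HB Require Import structures.
From mathcomp Require Import all_boot all_order all_algebra.
Set Implicit Arguments. Unset Strict Implicit. Unset Printing Implicit Defensive.
Import Order.TTheory GRing.Theory Num.Theory.

(* A set partition of [n] is a partition (in the sense of finset.v: nonempty,
   pairwise disjoint blocks covering everything) of the ordinal type 'I_n,
   where 'I_n = {0,...,n-1} stands for [n] = {1,...,n} (order preserved). *)
Definition is_setpart (n : nat) (P : {set {set 'I_n}}) : bool :=
  partition P [set: 'I_n].

Definition subpart (n : nat) (sigma' sigma : {set {set 'I_n}}) : bool :=
  [&& partition sigma' (cover sigma'),
      [forall B in sigma', exists C in sigma, B \subset C] &
      [forall B1 in sigma', forall B2 in sigma', forall C in sigma,
          ((B1 \subset C) && (B2 \subset C)) ==> (B1 == B2)]].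

Definition part_image (m n : nat) (f : 'I_m -> 'I_n) (pi : {set {set 'I_m}})
  : {set {set 'I_n}} := [set f @: (B : {set 'I_m}) | B in pi].

(* sigma contains pi: there is a subpartition sigma' of sigma with
   st(sigma') = pi.  Since st is the order-preserving bijection of the support
   S of sigma' onto [#S], st(sigma') = pi holds iff sigma' is the image of pi
   under the (unique) strictly increasing map f : [m] -> [n] with image S. *)
Definition contains (n m : nat) (sigma : {set {set 'I_n}})
  (pi : {set {set 'I_m}}) : bool :=
  [exists f : {ffun 'I_m -> 'I_n},
     [forall i : 'I_m, forall j : 'I_m, (i < j)%N ==> (f i < f j)%N] &&
     subpart (part_image f pi) sigma].

Definition avoids (n m : nat) (sigma : {set {set 'I_n}})
  (pi : {set {set 'I_m}}) : bool := ~~ contains sigma pi.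

Definition num_avoid (m : nat) (pi : {set {set 'I_m}}) (n : nat) : nat :=
  #|[set sigma : {set {set 'I_n}} | is_setpart sigma && avoids sigma pi]|.

Definition singletons_part (m : nat) : {set {set 'I_m}} :=
  [set [set i] | i : 'I_m].
Definition oneblock_part (m : nat) : {set {set 'I_m}} := [set [set: 'I_m]].
Definition pair_singletons_part (m : nat) : {set {set 'I_m}} :=
  [set [set i : 'I_m | (i < 2)%N]] :|: [set [set i] | i in [set i : 'I_m | (1 < i)%N]].

Definition P_recursive (a : nat -> nat) : Prop :=
  exists (k : nat) (P : 'I_k.+1 -> {poly rat}),
    (exists i, P i != 0%R) /\
    forall n : nat, (\sum_(i < k.+1) (P i).[n%:R] * (a (n + i)%N)%:R = 0)%R.

(* Main.v *)
Require Import Defs.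
From mathcomp Require Import all_boot all_order all_algebra.
From mathcomp Require Import ring zify.

(* Write a partition as its restricted growth word: the i-th letter is the label
   of the block of i, and labels appear in the order 0, 1, 2, ...  Containment
   of a pattern becomes occurrence of a subword with a given equality pattern,
   and avoiding words are counted by appending letters one at a time.

   For 1/2/.../m, 12/3/.../m, 13/2 and 1/23 this counting solves recurrences
   a(n+1) = l a(n) + b(n) with b already annihilated by a product of factors
   E - l_i, E the shift operator, so the counts are annihilated by such a
   product too.  For 12/3/.../m, once a letter a has been repeated, the only
   constraint on the rest of the word is that fewer than m - 2 distinct letters
   other than a occur in it; the number of completions is then a polynomial in
   the number k of letters used so far, and C-finiteness is proved for the
   sequence of these polynomials.

   For 12...m the avoiders have all blocks of size less than m, and removing
   the block of a fixed element gives
   a(n+1) = sum_(j < m - 1) 'C(n, j) a(n - j). *)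

Set Implicit Arguments.
Unset Strict Implicit.
Unset Printing Implicit Defensive.
Import GRing.Theory.

(** * Sequences annihilated by a product of operators [E - l] *)

Local Open Scope ring_scope.

(** The operators [E - l] are applied one after another, starting with the head of [s]. Values lie
    in a module because sequences of polynomials occur as well as sequences of rationals. *)
Fixpoint annihilates (V : lmodType rat) (s : seq rat) (a : nat -> V) : Prop :=
  if s is l :: s' then annihilates s' (fun n => a n.+1 - l *: a n)
  else forall n, a n = 0.

Definition C_finite (V : lmodType rat) (a : nat -> V) : Prop :=
  exists s, annihilates s a.

Lemma annihilates_ext (V : lmodType rat) s (a b : nat -> V) :
  a =1 b -> annihilates s a -> annihilates s b.
Proof.
elim: s a b => [|l s IHs] a b eq_ab /=; first by move=> a0 n; rewrite -eq_ab.
by apply: IHs => n; rewrite !eq_ab.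
Qed.

Lemma annihilates_linear (V W : lmodType rat) (f : V -> W) s a :
  (forall l u v, f (u - l *: v) = f u - l *: f v) ->
  annihilates s a -> annihilates s (fun n => f (a n)).
Proof.
move=> f_lin; elim: s a => [|l s IHs] a /=.
  (* The hypothesis gives [f 0 = 0] through [0 = 0 - 1 *: 0]. *)
  by move=> a0 n; rewrite a0 -[X in f X](subrr 0) -[X in 0 - X]scale1r f_lin scale1r subrr.
by move/IHs; apply: annihilates_ext => n; rewrite f_lin.
Qed.

Lemma annihilates_shift (V : lmodType rat) s (a : nat -> V) :
  annihilates s a -> annihilates s (fun n => a n.+1).
Proof. by elim: s a => [|l s IHs] a /= => [a0 n|/IHs]. Qed.

Lemma annihilates_add (V : lmodType rat) s (a b : nat -> V) :
  annihilates s a -> annihilates s b -> annihilates s (fun n => a n + b n).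
Proof.
elim: s a b => [|l s IHs] a b /=; first by move=> a0 b0 n; rewrite a0 b0 addr0.
move=> sa sb; apply: annihilates_ext (IHs _ _ sa sb) => n /=.
by rewrite scalerDr opprD addrACA.
Qed.

Lemma annihilates_catl (V : lmodType rat) s t (a : nat -> V) :
  annihilates s a -> annihilates (s ++ t) a.
Proof.
elim: s a => [|l s IHs] a //=; last exact: IHs.
elim: t a => [|l t IHt] a //= a0; apply: IHt => n.
by rewrite !a0 scaler0 subr0.
Qed.

(** Each [E - l] sends [a] to a combination of [a] and its shift, both annihilated by [t]. This
    plays the role of commuting the factors and gives two sequences a common annihilator. *)
Lemma annihilates_catr (V : lmodType rat) s t (a : nat -> V) :
  annihilates t a -> annihilates (s ++ t) a.
Proof.
elim: s a => [|l s IHs] a //= ta; apply: IHs.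
have f_lin k (u v : V) : - l *: (u - k *: v) = - l *: u - k *: (- l *: v).
  by rewrite scalerBr !scalerA mulrC.
apply: annihilates_ext (annihilates_add (annihilates_shift ta)
                          (annihilates_linear f_lin ta)) => n /=.
by rewrite scaleNr.
Qed.

Lemma C_finite_ext (V : lmodType rat) (a b : nat -> V) :
  a =1 b -> C_finite a -> C_finite b.
Proof. by move=> eq_ab [s sa]; exists s; apply: annihilates_ext sa. Qed.

Lemma C_finite0 (V : lmodType rat) : C_finite (fun _ => 0 : V).
Proof. by exists [::]. Qed.

Lemma C_finite_linear (V W : lmodType rat) (f : V -> W) a :
  (forall l u v, f (u - l *: v) = f u - l *: f v) ->
  C_finite a -> C_finite (fun n => f (a n)).
Proof. by move=> f_lin [s sa]; exists s; apply: annihilates_linear. Qed.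

Lemma C_finite_add (V : lmodType rat) (a b : nat -> V) :
  C_finite a -> C_finite b -> C_finite (fun n => a n + b n).
Proof.
move=> [s sa] [t tb]; exists (s ++ t).
by apply: annihilates_add; [apply: annihilates_catl | apply: annihilates_catr].
Qed.

Lemma C_finite_rec (V : lmodType rat) (l : rat) (a b : nat -> V) :
  C_finite b -> (forall n, a n.+1 = l *: a n + b n) -> C_finite a.
Proof.
move=> [s sb] arec; exists (l :: s); apply: annihilates_ext sb => n.
by rewrite arec addrAC subrr add0r.
Qed.

Lemma C_finite_const (V : lmodType rat) (v : V) : C_finite (fun _ => v).
Proof. by exists [:: 1] => n; rewrite scale1r subrr. Qed.

(** The factor [E - 0] is the shift itself, so a single initial value never matters. *)
Lemma C_finite_behead (V : lmodType rat) (a : nat -> V) :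
  C_finite (fun n => a n.+1) -> C_finite a.
Proof. by move=> Ca; apply: (C_finite_rec (l := 0) Ca) => n; rewrite scale0r add0r. Qed.

(** With [b] the image of [a] under [E - l], the operator [E - l] sends [n * a n] to
    [n * b n + a n.+1], and [b] has a shorter annihilator. *)
Lemma C_finite_mul_index (a : nat -> rat^o) :
  C_finite a -> C_finite (fun n => n%:R * a n : rat^o).
Proof.
move=> [s]; elim: s a => [|l s IHs] a /= sa.
  by apply: C_finite_ext (C_finite0 rat^o) => n; rewrite sa mulr0.
have Ca1 : C_finite (fun n => a n.+1) by exists (l :: s); apply: annihilates_shift.
apply: (C_finite_rec (l := l) (C_finite_add (IHs _ sa) Ca1)) => n /=.
by rewrite -natr1 /GRing.scale /=; ring.
Qed.

Lemma C_finite_horner (p : {poly rat}) : C_finite (fun n => p.[n%:R] : rat^o).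
Proof.
elim/poly_ind: p => [|p c Cp].
  by apply: C_finite_ext (C_finite0 _) => n; rewrite horner0.
apply: C_finite_ext (C_finite_add (C_finite_mul_index Cp) (C_finite_const (c : rat^o))) => n.
by rewrite hornerMXaddC mulrC.
Qed.

(* Hitting the recurrence with the operator annihilating [M] leaves the
   homogeneous equation, whose solutions are [F 0 \Po ('X + L)]: their values
   at [0] are polynomial in [L]. *)
Lemma C_finite_translation_rec (F M : nat -> {poly rat}) :
  C_finite M -> (forall L, F L.+1 = F L \Po ('X + 1) + M L) ->
  C_finite (fun L => (F L).[0] : rat^o).
Proof.
move=> [s]; elim: s F M => [|l s IHs] F M /= sM Frec.
  have FE L x : (F L).[x] = (F 0).[x + L%:R].
    elim: L x => [|L IHL] x; first by rewrite addr0.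
    by rewrite Frec sM addr0 horner_comp !hornerE IHL -natr1 -!addrA [1 + _]addrC.
  by apply: C_finite_ext (C_finite_horner (F 0)) => L; rewrite (FE L 0) add0r.
have /= := IHs (fun L => F L.+1 - l *: F L) _ sM.
move=> CF; apply: (C_finite_rec (l := l) (CF _)) => L.
  by rewrite !Frec /= comp_polyB comp_polyZ scalerDr opprD addrACA.
by rewrite hornerD hornerN hornerZ addrC subrK.
Qed.

(** The [c i] are the coefficients of the product of the [X - l]; being monic, it yields a
    nontrivial recurrence. *)
Lemma annihilates_coef s (a : nat -> rat^o) : annihilates s a ->
  exists2 c : nat -> rat, c (size s) = 1 &
    forall n, \sum_(i < (size s).+1) c i * a (n + i)%N = 0.
Proof.
elim: s a => [|l s IHs] a /= sa.
  by exists (fun=> 1) => // n; rewrite big_ord1 sa mulr0.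
have [c c1 csum] := IHs _ sa.
(* Multiplication by [X - l]. The guard is needed because [c] is arbitrary beyond [size s]. *)
exists (fun i => (if i is j.+1 then c j else 0) - (if (i <= size s)%N then l * c i else 0)).
  by rewrite ltnn subr0.
move=> n; rewrite -[RHS](csum n).
under eq_bigr do rewrite mulrBl.
rewrite sumrB big_ord_recl mul0r add0r [X in _ - X]big_ord_recr /= ltnn mul0r addr0 -sumrB.
apply: eq_bigr => i _; rewrite -ltnS ltn_ord /bump add1n addnS.
by rewrite /GRing.scale /=; ring.
Qed.

Lemma C_finite_P_recursive (a : nat -> nat) :
  C_finite (fun n => (a n)%:R : rat^o) -> P_recursive a.
Proof.
move=> [s /annihilates_coef[c c1 csum]].
exists (size s), (fun i => (c i)%:P); split.
  by exists ord_max; rewrite c1 polyC_eq0 oner_eq0.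
by move=> n; rewrite -[RHS](csum n); apply: eq_bigr => i _; rewrite hornerC.
Qed.

Local Close Scope ring_scope.

(** * Containment as occurrence of a subword *)

Lemma pblock_setpart n (sigma : {set {set 'I_n}}) B i :
  is_setpart sigma -> B \in sigma -> i \in B -> pblock sigma i = B.
Proof. by move=> /and3P[_ tI _]; apply: def_pblock. Qed.

Lemma mem_pblock_setpart n (sigma : {set {set 'I_n}}) i :
  is_setpart sigma -> i \in pblock sigma i.
Proof. by move=> /cover_partition covE; rewrite mem_pblock covE. Qed.

Lemma pblock_in_setpart n (sigma : {set {set 'I_n}}) i :
  is_setpart sigma -> pblock sigma i \in sigma.
Proof. by move=> /cover_partition covE; rewrite pblock_mem ?covE. Qed.

(** Each [f @: B] lying inside one block of [sigma] gives one implication; distinct blocks of [pi]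
    landing in distinct blocks of [sigma] gives the other. *)
Lemma subpart_imageP n m (sigma : {set {set 'I_n}}) (pi : {set {set 'I_m}})
    (f : 'I_m -> 'I_n) :
  is_setpart sigma -> is_setpart pi -> injective f ->
  reflect (forall i j, (pblock pi i == pblock pi j) =
                       (pblock sigma (f i) == pblock sigma (f j)))
          (subpart (part_image f pi) sigma).
Proof.
move=> Psigma Ppi inj_f; apply: (iffP and3P).
  move=> [_ /forall_inP sub_ex /forall_inP sub_inj] i j.
  have fB k : f @: pblock pi k \in part_image f pi.
    by apply: imset_f; apply: pblock_in_setpart.
  have fs k : f @: pblock pi k \subset pblock sigma (f k).
    have /exists_inP[C Csigma sBC] := sub_ex _ (fB k).
    rewrite (pblock_setpart Psigma Csigma) //.
    by apply: (subsetP sBC); apply: imset_f; apply: mem_pblock_setpart.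
  apply/eqP/eqP => eqB.
    have fi : f i \in pblock sigma (f j).
      apply: (subsetP (fs j)); apply: imset_f.
      by rewrite -eqB; apply: mem_pblock_setpart.
    by apply: pblock_setpart fi => //; apply: pblock_in_setpart.
  have /forall_inP/(_ _ (fB j))/forall_inP := sub_inj _ (fB i).
  move=> /(_ _ (pblock_in_setpart (f i) Psigma)).
  by rewrite fs eqB fs => /eqP/(imset_inj inj_f).
move=> ker_f.
have fs (B : {set 'I_m}) i : B \in pi -> i \in B -> f @: B \subset pblock sigma (f i).
  move=> Bpi iB; apply/subsetP=> _ /imsetP[j jB ->].
  have /eqP <- : pblock sigma (f j) == pblock sigma (f i).
    by rewrite -ker_f !(pblock_setpart Ppi Bpi).
  exact: mem_pblock_setpart.
split.
- rewrite /part_image cover_imset -imset_cover imset_partition //.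
  by rewrite (cover_partition Ppi).
- apply/forall_inP=> _ /imsetP[B Bpi ->].
  have /set0Pn[i iB] := partition_neq0 Ppi Bpi.
  apply/exists_inP; exists (pblock sigma (f i)); last exact: fs.
  exact: pblock_in_setpart.
- apply/forall_inP=> _ /imsetP[B1 B1pi ->]; apply/forall_inP=> _ /imsetP[B2 B2pi ->].
  apply/forall_inP=> C Csigma; apply/implyP=> /andP[s1 s2].
  have /set0Pn[i iB] := partition_neq0 Ppi B1pi.
  have /set0Pn[j jB] := partition_neq0 Ppi B2pi.
  rewrite -(pblock_setpart Ppi B1pi iB) -(pblock_setpart Ppi B2pi jB).
  suff /eqP -> : pblock pi i == pblock pi j by [].
  rewrite ker_f (pblock_setpart Psigma Csigma) ?(pblock_setpart Psigma Csigma) //.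
    by apply: (subsetP s2); apply: imset_f.
  by apply: (subsetP s1); apply: imset_f.
Qed.

(* Reading a partition as the word of its block labels, [contains] is
   occurrence of a subword with the prescribed equality pattern. *)
Definition word_contains (T : eqType) m (pi : {set {set 'I_m}}) (w : seq T) : Prop :=
  exists2 v : m.-tuple T, subseq v w &
    forall i j, (pblock pi i == pblock pi j) = (tnth v i == tnth v j).

Lemma sorted_enum_ord n : sorted (fun i j : 'I_n => i < j) (enum 'I_n).
Proof.
have := iota_ltn_sorted 0 n.
by rewrite -val_enum_ord sorted_map.
Qed.

(** Increasing maps into ['I_n] are the subsequences of its enumeration, and only the kernel of the
    labelling matters. *)
Lemma containsP (T : eqType) n m (sigma : {set {set 'I_n}}) (pi : {set {set 'I_m}})
    (lab : 'I_n -> T) :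
  is_setpart sigma -> is_setpart pi ->
  (forall i j, (pblock sigma i == pblock sigma j) = (lab i == lab j)) ->
  contains sigma pi <-> word_contains pi [seq lab i | i <- enum 'I_n].
Proof.
move=> Psigma Ppi labE.
have ltn_ord_trans k : transitive (fun i j : 'I_k => i < j).
  by move=> x y z; apply: ltn_trans.
split.
  case/existsP=> f /andP[/'forall_'forall_implyP f_incr sub_f].
  have inj_f : injective f.
    move=> i j eq_f; apply/val_inj/eqP; case: ltngtP => //.
      by move/f_incr; rewrite eq_f ltnn.
    by move/f_incr; rewrite eq_f ltnn.
  have ker_f := subpart_imageP Psigma Ppi inj_f sub_f.
  exists [tuple lab (f i) | i < m].
    rewrite /= (map_comp lab f); apply: map_subseq.
    have sorted_f : sorted (fun i j : 'I_n => i < j) (map f (enum 'I_m)).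
      by apply: homo_sorted (sorted_enum_ord m) => i j /f_incr.
    (* A strictly increasing list is determined by its set of members. *)
    suff -> : map f (enum 'I_m) = [seq i <- enum 'I_n | i \in codom f].
      exact: filter_subseq.
    apply: (irr_sorted_eq (@ltn_ord_trans n)) => //.
    - by move=> x; apply: ltnn.
    - exact (sorted_filter (@ltn_ord_trans n) _ (sorted_enum_ord n)).
    - by move=> x; rewrite mem_filter mem_enum andbT /codom.
  by move=> i j; rewrite !tnth_mktuple ker_f labE.
(* The mask that cuts [v] out of the word also cuts out the list [t] of its positions, which is
   increasing and defines [f]. *)
case=> v /subseqP[b size_b vE] ker_v.
rewrite -map_mask in vE; set t := mask b _ in vE.
have size_t : size t = m by rewrite -(size_map lab) -vE size_tuple.
have t_sorted : sorted (fun i j : 'I_n => i < j) t.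
  exact (sorted_mask (@ltn_ord_trans n) _ (sorted_enum_ord n)).
have tP (i : 'I_m) : i < size t by rewrite size_t.
have /'forall_'forall_implyP f_incr :
    [forall i : 'I_m, forall j : 'I_m, (i < j) ==>
      (tnth (in_tuple t) (Ordinal (tP i)) < tnth (in_tuple t) (Ordinal (tP j)))].
  apply/'forall_'forall_implyP => i j lt_ij.
  have x0 : 'I_n := tnth (in_tuple t) (Ordinal (tP i)).
  rewrite !(tnth_nth x0) /=.
  by apply: (sorted_ltn_nth (@ltn_ord_trans n) x0 t_sorted); rewrite ?inE ?size_t.
pose f := [ffun i => tnth (in_tuple t) (Ordinal (tP i))].
have inj_f : injective f.
  move=> i j; rewrite !ffunE => eq_f; apply/val_inj/eqP; case: ltngtP => //.
    by move/f_incr; rewrite eq_f ltnn.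
  by move/f_incr; rewrite eq_f ltnn.
apply/existsP; exists f; apply/andP; split.
  by apply/'forall_'forall_implyP => i j; rewrite !ffunE; apply: f_incr.
apply/(subpart_imageP Psigma Ppi inj_f) => i j.
have fE k : lab (f k) = tnth v k.
  by rewrite ffunE (tnth_nth (tnth v k)) vE (tnth_nth (f k)) (nth_map (f k)).
by rewrite labE !fE.
Qed.

(** * Counting partitions letter by letter *)

Lemma pblock_preim_partition (T : finType) (rT : eqType) (f : T -> rT) x y :
  (pblock (preim_partition f [set: T]) x == pblock (preim_partition f [set: T]) y)
    = (f x == f y).
Proof.
have /and3P[/eqP covP tiP _] := preim_partitionP f [set: T].
rewrite eq_pblock ?covP ?inE // pblock_equivalence_partition ?inE //.
by split=> // /eqP->.
Qed.

Lemma preim_partition_ker (T : finType) (rT rT' : eqType) (f : T -> rT) (g : T -> rT') :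
  (forall x y, (f x == f y) = (g x == g y)) ->
  preim_partition f [set: T] = preim_partition g [set: T].
Proof.
by move=> eq_fg; apply: eq_imset => x; apply/setP=> y; rewrite !inE eq_fg.
Qed.

(* The number of ways to complete [w], a word on the letters [0, ..., k - 1],
   by [L] more letters to a word in [good], when a new letter must be the
   smallest unused one. *)
Fixpoint ext_count (good : pred (seq nat)) (L k : nat) (w : seq nat) : nat :=
  if L is L'.+1 then
    \sum_(c < k) ext_count good L' k (rcons w c) + ext_count good L' k.+1 (rcons w k)
  else good w.

Lemma ext_count0 good k w : ext_count good 0 k w = good w.
Proof. by []. Qed.

Lemma ext_countS good L k w : ext_count good L.+1 k w =
  \sum_(c < k) ext_count good L k (rcons w c) + ext_count good L k.+1 (rcons w k).
Proof. by []. Qed.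

(** Only the first [size w] elements are constrained: [w] may be a proper prefix of the word of
    [sigma]. *)
Definition labelled_by n (w : seq nat) (sigma : {set {set 'I_n}}) : bool :=
  [forall i : 'I_n, forall j : 'I_n, (i < size w) && (j < size w) ==>
     ((pblock sigma i == pblock sigma j) == (nth 0 w i == nth 0 w j))].

Lemma labelled_rcons n w c (sigma : {set {set 'I_n}}) (r : 'I_n) :
  size w = r ->
  reflect (labelled_by w sigma /\
           forall i : 'I_n, i < r -> (pblock sigma i == pblock sigma r) = (nth 0 w i == c))
          (labelled_by (rcons w c) sigma).
Proof.
move=> size_w; apply: (iffP 'forall_'forall_implyP) => [labw|[]].
  split; last first.
    move=> i lt_ir; have := labw i r; rewrite size_rcons size_w ltnS ltnW // leqnn.
    by move=> /(_ isT)/eqP ->; rewrite !nth_rcons size_w lt_ir ltnn eqxx.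
  apply/'forall_'forall_implyP => i j /andP[lt_i lt_j].
  by have := labw i j; rewrite size_rcons !ltnS !(ltnW lt_i, ltnW lt_j) !nth_rcons lt_i lt_j; apply.
move/'forall_'forall_implyP => labw labc i j.
rewrite size_rcons !ltnS !nth_rcons size_w => /andP[le_i le_j].
have [lt_i|ge_i] := ltnP i r; have [lt_j|ge_j] := ltnP j r.
- by apply: labw; rewrite size_w lt_i.
- have -> : j = r by apply/val_inj/eqP; rewrite eqn_leq le_j.
  by rewrite eqxx labc.
- have -> : i = r by apply/val_inj/eqP; rewrite eqn_leq le_i.
  by rewrite eqxx [pblock _ _ == _]eq_sym [c == _]eq_sym labc.
have -> : i = r by apply/val_inj/eqP; rewrite eqn_leq le_i.
have -> : j = r by apply/val_inj/eqP; rewrite eqn_leq le_j.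
by rewrite !eqxx.
Qed.

(** Induction on the number of unlabelled elements: the next element [r] joins one of the [k] blocks
    already met or opens a new one, labelled [k]. *)
Lemma card_labelled n (good : pred (seq nat)) (Q : pred {set {set 'I_n}}) :
  (forall sigma w, is_setpart sigma -> size w = n -> labelled_by w sigma ->
     Q sigma = good w) ->
  forall L k w, size w + L = n -> (forall c, (c \in w) = (c < k)) ->
  #|[set sigma : {set {set 'I_n}} | [&& is_setpart sigma, labelled_by w sigma & Q sigma]]|
    = ext_count good L k w.
Proof.
move=> Qgood; elim=> [|L IHL] k w size_w w_letters.
  rewrite addn0 in size_w; pose lab (i : 'I_n) := nth 0 w i.
  have labelledE sigma : is_setpart sigma ->
      labelled_by w sigma = (sigma == preim_partition lab setT).
    move=> Psigma; apply/'forall_'forall_implyP/eqP => [labw|-> i j _].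
      rewrite -(preim_partition_pblock Psigma); apply: preim_partition_ker => x y.
      by apply: eqP (labw _ _ _); rewrite size_w !ltn_ord.
    by rewrite pblock_preim_partition.
  have P0 := preim_partitionP lab [set: 'I_n].
  have lab0 : labelled_by w (preim_partition lab [set: 'I_n]) by rewrite labelledE.
  rewrite /=; case Gw: (good w).
    apply/eqP/cards1P; exists (preim_partition lab setT).
    apply/setP=> sigma; rewrite !inE; apply/and3P/eqP => [[Ps labs _]|->].
      by apply/eqP; rewrite -labelledE.
    by rewrite (Qgood _ w).
  apply/eqP; rewrite cards_eq0; apply/eqP/setP=> sigma; rewrite !inE.
  by apply/negP=> /and3P[Ps labs]; rewrite (Qgood _ w) // Gw.
have lt_r : size w < n by rewrite -size_w addnS ltnS leq_addr.
pose r := Ordinal lt_r.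
pose S (c : nat) := [set sigma : {set {set 'I_n}} |
  [&& is_setpart sigma, labelled_by (rcons w c) sigma & Q sigma]].
have letter_pos c : c < k -> exists2 i : 'I_n, i < r & nth 0 w i = c.
  rewrite -w_letters => cw; have lt_i : index c w < size w by rewrite index_mem.
  by exists (Ordinal (ltn_trans lt_i lt_r)); rewrite //= nth_index.
have rconsP c sigma := @labelled_rcons n w c sigma r (erefl _).
have -> : [set sigma : {set {set 'I_n}} |
    [&& is_setpart sigma, labelled_by w sigma & Q sigma]] = \bigcup_(c < k.+1) S c.
  apply/setP=> sigma; rewrite !inE; apply/and3P/bigcupP => [[Ps labs Qs]|]; last first.
    by case=> c _; rewrite inE => /and3P[Ps /rconsP[labs _] Qs].
  have [/existsP[i /andP[lt_i /eqP eq_i]]|] :=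
    boolP [exists i : 'I_n, (i < r) && (pblock sigma i == pblock sigma r)].
    have lt_c : nth 0 w i < k by rewrite -w_letters mem_nth.
    exists (Ordinal (ltnW lt_c : nth 0 w i < k.+1)) => //.
    rewrite inE Ps Qs andbT; apply/rconsP; split=> // j lt_j; rewrite -eq_i.
    by move/'forall_'forall_implyP: labs => /(_ j i) /=; rewrite lt_i lt_j => /(_ isT)/eqP.
  move=> /existsPn no_i; exists ord_max => //.
  rewrite inE Ps Qs andbT; apply/rconsP; split=> // j lt_j.
  have := no_i j; rewrite lt_j /= => /negbTE ->; apply/esym/negbTE.
  by rewrite neq_ltn -w_letters mem_nth.
rewrite -sum1_card partition_disjoint_bigcup; last first.
  move=> c d neq_cd; rewrite -setI_eq0; apply/eqP/setP=> sigma; rewrite !inE.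
  apply/negP=> /andP[/and3P[_ /rconsP[_ labc] _] /and3P[_ /rconsP[_ labd] _]].
  wlog lt_cd : c d neq_cd labc labd / c < d.
    move=> IH; move: (neq_cd); rewrite -val_eqE neq_ltn => /orP[lt_cd|lt_dc].
      exact: (IH c d neq_cd labc labd lt_cd).
    by apply: (IH d c _ labd labc lt_dc); rewrite eq_sym.
  (* Only the larger label [d] can be new, so some earlier element carries [c]; it would lie in the
     block of [r] according to [c] but not according to [d]. *)
  have [i lt_i wi] := letter_pos c (leq_trans lt_cd (leq_ord d)).
  have := labc i lt_i; rewrite labd // wi eqxx => /eqP eq_cd.
  by rewrite eq_cd ltnn in lt_cd.
under eq_bigr do rewrite sum1_card.
have lettersP c : c <= k ->
    forall d, (d \in rcons w c) = (d < (if c < k then k else k.+1)).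
  move=> le_ck d; rewrite mem_rcons inE w_letters.
  have [lt_ck|ge_ck] := ltnP c k; last first.
    by rewrite (anti_leq (introT andP (conj le_ck ge_ck))) ltnS [RHS]leq_eqVlt.
  by case: eqP => // ->; rewrite lt_ck.
rewrite big_ord_recr /=; congr (_ + _).
  apply: eq_bigr => c _; apply: IHL.
    by rewrite size_rcons addSnnS.
  by move=> d; rewrite lettersP ?ltn_ord // ltnW.
apply: IHL; first by rewrite size_rcons addSnnS.
by move=> d; rewrite lettersP // ltnn.
Qed.

(** Going back to the partition given by the kernel of the word makes avoidance boolean, as
    [ext_count] requires. *)
Definition word_avoids m (pi : {set {set 'I_m}}) (w : seq nat) : bool :=
  avoids (preim_partition (fun i : 'I_(size w) => nth 0 w i) setT) pi.

Lemma map_nth_enum_ord n (w : seq nat) :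
  size w = n -> [seq nth 0 w (i : 'I_n) | i <- enum 'I_n] = w.
Proof.
move=> size_w; rewrite (map_comp (nth 0 w) val) val_enum_ord -size_w.
by rewrite map_nth_iota0 // take_size.
Qed.

Lemma word_avoidsP m (pi : {set {set 'I_m}}) w :
  is_setpart pi -> reflect (~ word_contains pi w) (word_avoids pi w).
Proof.
move=> Ppi; pose lab (i : 'I_(size w)) := nth 0 w i.
have := containsP (preim_partitionP lab setT) Ppi (pblock_preim_partition lab).
rewrite map_nth_enum_ord // => csP.
apply: (iffP idP) => [/negP ncs /csP // | nw].
by apply/negP => /csP.
Qed.

Lemma num_avoid_ext_count m (pi : {set {set 'I_m}}) n :
  is_setpart pi -> num_avoid pi n = ext_count (word_avoids pi) n 0 [::].
Proof.
move=> Ppi.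
rewrite -(@card_labelled n (word_avoids pi) (fun sigma => avoids sigma pi)) //.
  rewrite /num_avoid; congr #|pred_of_set _|; apply/setP=> sigma; rewrite !inE.
  have -> // : labelled_by [::] sigma.
  by apply/'forall_'forall_implyP.
move=> sigma w Ps size_w /'forall_'forall_implyP labw.
have labE (i j : 'I_n) : (pblock sigma i == pblock sigma j) = (nth 0 w i == nth 0 w j).
  by apply: eqP (labw _ _ _); rewrite size_w !ltn_ord.
have := containsP Ps Ppi labE; rewrite map_nth_enum_ord // => csP.
by apply/negP/(word_avoidsP w Ppi) => [ncs /csP // | nw /csP].
Qed.

Lemma word_contains_rcons m (pi : {set {set 'I_m}}) (w : seq nat) c :
  word_contains pi w -> word_contains pi (rcons w c).
Proof.
case=> v sub_v ker_v; exists v => //.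
exact: subseq_trans sub_v (subseq_rcons w c).
Qed.

Lemma ext_count_contains m (pi : {set {set 'I_m}}) L k w :
  is_setpart pi -> word_contains pi w -> ext_count (word_avoids pi) L k w = 0.
Proof.
move=> Ppi; elim: L k w => [|L IHL] k w cw /=.
  by case: (word_avoidsP w Ppi).
rewrite IHL ?big1 // => [c _|]; first by apply: IHL; apply: word_contains_rcons.
exact: word_contains_rcons.
Qed.

(** * The patterns 1/2/.../m and 12/3/.../m *)

Lemma preim_partition_eq (T : finType) (P : {set {set T}}) (rT : eqType) (f : T -> rT) :
  partition P [set: T] -> (forall x y, (pblock P x == pblock P y) = (f x == f y)) ->
  P = preim_partition f [set: T].
Proof. by move=> PP /preim_partition_ker <-; rewrite preim_partition_pblock. Qed.

Lemma word_contains_preim (T rT : eqType) m (f : 'I_m -> rT) (w : seq T) :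
  word_contains (preim_partition f setT) w <->
  exists2 v : m.-tuple T, subseq v w & forall i j, (f i == f j) = (tnth v i == tnth v j).
Proof.
by split=> -[v sub_v ker_v]; exists v => // i j; rewrite -ker_v pblock_preim_partition.
Qed.

Lemma singletons_partE m : singletons_part m = preim_partition id setT.
Proof.
have S (i : 'I_m) : [set y in [set: 'I_m] | id i == id y] = [set i].
  by apply/setP=> j; rewrite !inE eq_sym.
by apply/setP=> B; apply/imsetP/imsetP => -[i _ ->]; exists i; rewrite -?S ?inE.
Qed.

Lemma oneblock_partE m : 0 < m -> oneblock_part m = preim_partition (fun=> tt) setT.
Proof.
case: m => // m _; apply/setP=> B; rewrite inE.
have S : [set y in [set: 'I_m.+1] | tt == tt] = setT.
  by apply/setP=> j; rewrite !inE eqxx.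
apply/eqP/imsetP => [->|[i _ ->]]; last exact: S.
by exists ord0; rewrite ?inE.
Qed.

(** The map [maxn 1] merges 0 and 1 and fixes all larger indices. *)
Lemma pair_singletons_partE m :
  1 < m -> pair_singletons_part m = preim_partition (fun i : 'I_m => maxn 1 i) setT.
Proof.
case: m => [|[|m]] // _; apply/setP=> B; rewrite !inE.
pose S (i : 'I_m.+2) := [set y in [set: 'I_m.+2] | maxn 1 i == maxn 1 y].
have S01 (i : 'I_m.+2) : i < 2 -> S i = [set j : 'I_m.+2 | j < 2].
  by move=> lt_i; apply/setP=> j; rewrite !inE; apply/eqP/idP; lia.
have S2 (i : 'I_m.+2) : 1 < i -> S i = [set i].
  move=> lt_i; apply/setP=> j; rewrite !inE -val_eqE /=; apply/eqP/eqP; lia.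
apply/orP/imsetP => [[/eqP->|/imsetP[i]]|[i _ ->]].
- by exists ord0; rewrite ?inE // -/(S ord0) S01.
- by rewrite inE => lt_i ->; exists i; rewrite ?inE // -/(S i) S2.
rewrite -/(S i); have [lt_i|le_i] := ltnP i 2; first by left; rewrite S01.
by right; rewrite S2 //; apply/imsetP; exists i; rewrite ?inE.
Qed.

Lemma size_undup_letters k (w : seq nat) :
  (forall c, (c \in w) = (c < k)) -> size (undup w) = k.
Proof.
move=> w_letters; rewrite -(size_iota 0 k); apply/perm_size/uniq_perm.
- exact: undup_uniq.
- exact: iota_uniq.
by move=> c; rewrite mem_undup mem_iota w_letters.
Qed.

Lemma subseq_cat_split (T : eqType) (s t1 t2 : seq T) : subseq s (t1 ++ t2) ->
  exists s1 s2, [/\ s = s1 ++ s2, subseq s1 t1 & subseq s2 t2].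
Proof.
case/subseqP=> b size_b ->; exists (mask (take (size t1) b) t1).
exists (mask (drop (size t1) b) t2); rewrite !mask_subseq; split=> //.
by rewrite -mask_cat ?cat_take_drop // size_take size_b size_cat; case: ltnP; lia.
Qed.

Lemma card_letters k (t : seq nat) :
  uniq t -> (forall c, c \in t -> c < k) -> #|[pred c : 'I_k | val c \in t]| = size t.
Proof.
move=> uniq_t lt_t; rewrite cardE -(size_map val); apply/perm_size/uniq_perm => //.
  by rewrite map_inj_uniq ?enum_uniq //; apply: val_inj.
move=> c; apply/mapP/idP => [[d]|tc]; first by rewrite mem_enum => td ->.
by exists (Ordinal (lt_t c tc)); rewrite ?mem_enum ?inE.
Qed.

Lemma sum_if_letter k (t : seq nat) (x y : rat) :
  uniq t -> (forall c, c \in t -> c < k) ->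
  (\sum_(c < k) (if val c \in t then x else y) =
    (size t)%:R * x + (k%:R - (size t)%:R) * y)%R.
Proof.
move=> uniq_t lt_t; pose P := [pred c : 'I_k | val c \in t].
rewrite (bigID P) /= (eq_bigr (fun=> x)) => [|c -> //].
rewrite [X in (_ + X)%R](eq_bigr (fun=> y)) => [|c /negbTE -> //].
rewrite -(card_letters uniq_t lt_t) -/P !sumr_const !mulr_natl.
have := cardC P; rewrite card_ord => /(congr1 (fun n => n%:R%R : rat)).
rewrite natrD => <-; rewrite [(_ + _%:R)%R]addrC addrK mulr_natl.
by congr (_ + _ *+ _)%R.
Qed.

Lemma eq_size_undup (s t : seq nat) : s =i t -> size (undup s) = size (undup t).
Proof.
move=> eq_st; apply/perm_size/uniq_perm; rewrite ?undup_uniq // => x.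
by rewrite !mem_undup.
Qed.

Lemma letters_rcons_old k (w : seq nat) d :
  (forall c, (c \in w) = (c < k)) -> d < k -> forall c, (c \in rcons w d) = (c < k).
Proof.
by move=> w_letters lt_d c; rewrite mem_rcons inE w_letters; case: eqP => // ->.
Qed.

Lemma letters_rcons_new k (w : seq nat) :
  (forall c, (c \in w) = (c < k)) -> forall c, (c \in rcons w k) = (c < k.+1).
Proof. by move=> w_letters c; rewrite mem_rcons inE w_letters ltnS [RHS]leq_eqVlt. Qed.

(** * The pattern 1/2/.../m: a bounded number of blocks *)

Section Singletons.
Variable m : nat.

Lemma word_contains_singletons (w : seq nat) :
  word_contains (singletons_part m) w <-> m <= size (undup w).
Proof.
rewrite singletons_partE; split=> [/word_contains_preim[v sub_v ker_v]|le_m].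
  have uniq_v : uniq v.
    by apply/tuple_uniqP => i j eq_v; apply/eqP; rewrite ker_v eq_v.
  rewrite -(size_tuple v); apply: uniq_leq_size => // x /(mem_subseq sub_v).
  by rewrite mem_undup.
apply/word_contains_preim.
have size_v : size (take m (undup w)) == m by rewrite size_takel.
exists (Tuple size_v) => /=.
  exact: subseq_trans (take_subseq _ _) (undup_subseq w).
move=> i j; apply/eqP/eqP => [->//|]; apply/tuple_uniqP.
by rewrite /= take_uniq ?undup_uniq.
Qed.

(** Here [k] is the number of blocks opened so far; avoiders end with fewer than [m] of them. *)
Fixpoint block_bounded_count L k : nat :=
  if L is L'.+1 then k * block_bounded_count L' k + block_bounded_count L' k.+1
  else k < m.

Lemma ext_count_singletons L k w :
  (forall c, (c \in w) = (c < k)) ->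
  ext_count (word_avoids (singletons_part m)) L k w = block_bounded_count L k.
Proof.
have Ppi : is_setpart (singletons_part m).
  by rewrite singletons_partE; apply: preim_partitionP.
elim: L k w => [|L IHL] k w w_letters /=.
  congr nat_of_bool; apply/(word_avoidsP w Ppi)/idP.
    move=> nw; rewrite ltnNge; apply/negP => le_m; apply: nw.
    by apply/word_contains_singletons; rewrite (size_undup_letters w_letters).
  move=> lt_m /word_contains_singletons.
  by rewrite (size_undup_letters w_letters) leqNgt lt_m.
rewrite (eq_bigr (fun=> block_bounded_count L k)) => [|c _]; last first.
  by apply: IHL; apply: letters_rcons_old.
by rewrite sum_nat_const card_ord IHL //; apply: letters_rcons_new.
Qed.

Lemma P_recursive_singletons : P_recursive (num_avoid (singletons_part m)).
Proof.
have Ppi : is_setpart (singletons_part m).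
  by rewrite singletons_partE; apply: preim_partitionP.
apply: C_finite_P_recursive.
suff Ck k : C_finite (fun L => (block_bounded_count L k)%:R%R : rat^o).
  apply: C_finite_ext (Ck 0) => n /=.
  by rewrite num_avoid_ext_count // ext_count_singletons.
(* Downward induction on [k]: the count vanishes for [k >= m], and each smaller [k] contributes a
   factor [E - k]. *)
have [d le_m] : exists d, m <= k + d by exists m; apply: leq_addl.
elim: d k le_m => [|d IHd] k le_m.
  apply: C_finite_ext (C_finite0 _) => L.
  suff -> : block_bounded_count L k = 0 by [].
  rewrite addn0 in le_m; elim: L k le_m => [|L IHL] k le_m /=.
    by rewrite ltnNge le_m.
  by rewrite !IHL ?muln0 // leqW.
rewrite addnS -addSn in le_m.
apply: (C_finite_rec (l := k%:R%R) (IHd _ le_m)) => L /=.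
by rewrite natrD natrM.
Qed.
End Singletons.

(** * The pattern 12/3/.../m: the effect of the first repeated letter *)

Section PairSingletons.
Variable m : nat.

(** With the size written [m.+2], [m] counts the singleton blocks. *)
Let pi := pair_singletons_part m.+2.

Lemma setpart_pair_singletons : is_setpart pi.
Proof. by rewrite /pi pair_singletons_partE //; apply: preim_partitionP. Qed.

Lemma word_contains_pair_singletons (w : seq nat) :
  word_contains pi w <->
  exists a u, [/\ subseq (a :: a :: u) w, uniq (a :: u) & size u = m].
Proof.
rewrite /pi pair_singletons_partE //.
split=> [/word_contains_preim[v sub_v ker_v]|[a [u [sub_u uniq_u size_u]]]].
  have {}ker_v (i j : 'I_m.+2) : (maxn 1 i == maxn 1 j) = (nth 0 v i == nth 0 v j).
    by rewrite ker_v !(tnth_nth 0).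
  case: v sub_v ker_v => -[|a [|b u]] //= size_v sub_v ker_v.
  have eq_ab : a = b.
    by have := ker_v ord0 (inord 1); rewrite inordK //= => /esym/eqP.
  rewrite -{b}eq_ab in size_v sub_v ker_v *.
  move: (size_v) => /eqP[size_u].
  exists a, u; split=> //; apply: (introT (@uniqP _ 0 (a :: u))) => i j.
  rewrite !inE /= size_u => lt_i lt_j eq_ij.
  have := ker_v (inord i.+1) (inord j.+1).
  by rewrite !inordK //= eq_ij eqxx => /eqP; lia.
have size_v : size (a :: a :: u) == m.+2 by rewrite /= size_u.
apply/word_contains_preim; exists (Tuple size_v) => // i j.
rewrite !(tnth_nth 0) /=.
have nthE (k : nat) : nth 0 (a :: a :: u) k = nth 0 (a :: u) (maxn 1 k).-1.
  by case: k => [|[|k]].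
rewrite !nthE nth_uniq //= ?size_u; last 2 first.
- by have := ltn_ord i; lia.
- by have := ltn_ord j; lia.
by apply/eqP/eqP; lia.
Qed.

(* Once the letter [a] has been repeated, with [v] still to be read, only the
   number of distinct letters of [v] other than [a] matters. *)
Definition other_letters (a : nat) (v : seq nat) : nat :=
  size (undup [seq x <- v | x != a]).

Lemma other_letters_rcons a v c :
  other_letters a (rcons v c) = other_letters a v + ((c != a) && (c \notin v)).
Proof.
rewrite /other_letters filter_rcons; have [->|ne_ca] /= := eqVneq c a.
  by rewrite addn0.
have [cv|ncv] /= := boolP (c \in v).
  rewrite addn0; apply: eq_size_undup => x; rewrite mem_rcons inE mem_filter.
  by case: eqP => // ->; rewrite ne_ca cv.
rewrite undup_rcons size_rcons addn1 filter_undup -filter_predI; congr (size (undup _)).+1.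
apply: eq_in_filter => x xv /=; case: eqP => // eq_xc.
by rewrite -eq_xc xv in ncv.
Qed.

Lemma uniq_avoids_pair_singletons (w : seq nat) : uniq w -> ~ word_contains pi w.
Proof.
move=> uniq_w /word_contains_pair_singletons[a [u [/subseq_uniq/(_ uniq_w) + _ _]]].
by rewrite /= inE eqxx.
Qed.

(** As [p] has no repetition, the second [b] of an occurrence [b b u] falls in [a :: v], so [b :: u]
    is a subword of [a :: v]. Conversely [a] itself can serve as the doubled letter. *)
Lemma repeat_contains_pair_singletons (p v : seq nat) a : uniq p -> a \in p ->
  word_contains pi (p ++ a :: v) <-> m <= other_letters a v.
Proof.
move=> uniq_p pa; split=> [/word_contains_pair_singletons[b [u [sub_u uniq_u size_u]]]|le_m].
  have {}sub_u : subseq (b :: u) (a :: v).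
    have [[|c [|d s1]] [s2 [eq_u sub1 sub2]]] := subseq_cat_split sub_u.
    - by rewrite -[s2]/([::] ++ s2) -eq_u in sub2; apply: cons_subseq sub2.
    - by case: eq_u => _ ->.
    case: eq_u => eq_c eq_d _; have := subseq_uniq sub1 uniq_p.
    by rewrite -eq_c -eq_d /= inE eqxx.
  (* Of the [m.+1] distinct letters of [b :: u], at most one equals [a]. *)
  apply: (@leq_trans (size [seq x <- b :: u | x != a])).
    rewrite size_filter -ltnS -size_u -[(size u).+1]/(size (b :: u)).
    rewrite -(count_predC (pred1 a)) count_uniq_mem // -[X in _ <= X]add1n.
    by rewrite leq_add2r leq_b1.
  apply: uniq_leq_size; first exact: filter_uniq.
  move=> x; rewrite mem_undup !mem_filter => /andP[ne_xa /(mem_subseq sub_u)].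
  by rewrite inE (negbTE ne_xa).
apply/word_contains_pair_singletons.
exists a, (take m (undup [seq x <- v | x != a])); split.
- rewrite -cat1s; apply: cat_subseq; first by rewrite sub1seq.
  rewrite -[a :: take _ _]cat1s -[a :: v]cat1s subseq_cat2l.
  apply: subseq_trans (take_subseq _ _) _.
  exact: subseq_trans (undup_subseq _) (filter_subseq _ _).
- rewrite cons_uniq take_uniq ?undup_uniq // andbT.
  by apply/negP => /mem_take; rewrite mem_undup mem_filter eqxx.
by rewrite size_takel.
Qed.

(* The next letter is [a] or one of the [d] others met since its repetition, or
   one of the [k - (d + 1)] remaining old letters, or the new letter [k]; the
   variable of the polynomial stands for [k]. *)
Fixpoint completions_after_repeat (L d : nat) : {poly rat} :=
  if L is L'.+1 then
    (d.+1%:R *: completions_after_repeat L' d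
     + (('X - d.+1%:R%:P) * completions_after_repeat L' d.+1
        + (completions_after_repeat L' d.+1 \Po ('X + 1))))%R
  else ((d < m)%:R%:P)%R.

Lemma ext_count_after_repeat L k (p v : seq nat) a :
  uniq p -> a \in p -> (forall c, (c \in p ++ a :: v) = (c < k)) ->
  ((ext_count (word_avoids pi) L k (p ++ a :: v))%:R =
    (completions_after_repeat L (other_letters a v)).[k%:R])%R.
Proof.
move=> uniq_p pa; elim: L k v => [|L IHL] k v w_letters /=.
  rewrite hornerC; congr ((nat_of_bool _)%:R)%R.
  apply/(word_avoidsP _ setpart_pair_singletons)/idP.
    by move=> nw; rewrite ltnNge; apply/negP => /(repeat_contains_pair_singletons v uniq_p pa).
  by move=> lt_m /(repeat_contains_pair_singletons v uniq_p pa); rewrite leqNgt lt_m.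
have rcons_old c : c < k ->
    ((ext_count (word_avoids pi) L k (rcons (p ++ a :: v) c))%:R =
     (completions_after_repeat L (other_letters a (rcons v c))).[k%:R])%R.
  move=> lt_c; rewrite rcons_cat rcons_cons IHL // -rcons_cons -rcons_cat.
  exact: letters_rcons_old.
set d := other_letters a v.
(* The letters of [t] are those whose addition leaves [d] unchanged. *)
pose t := a :: undup [seq x <- v | x != a].
have uniq_t : uniq t.
  by rewrite /= undup_uniq andbT mem_undup mem_filter eqxx.
have lt_t c : c \in t -> c < k.
  rewrite -w_letters mem_cat !inE mem_undup mem_filter.
  by case: eqP => //=; rewrite ?orbT // => _ ->; rewrite orbT.
have otherE c : other_letters a (rcons v c) = if c \in t then d else d.+1.
  rewrite other_letters_rcons inE mem_undup mem_filter.
  by case: eqP => //= _; rewrite ?addn0 //; case: (c \in v); rewrite ?addn0 ?addn1.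
rewrite natrD natr_sum (eq_bigr (fun c : 'I_k =>
    if val c \in t then (completions_after_repeat L d).[k%:R]
    else (completions_after_repeat L d.+1).[k%:R])%R); last first.
  by move=> c _; rewrite rcons_old // otherE; case: ifP.
rewrite rcons_cat rcons_cons IHL; last first.
  by rewrite -rcons_cons -rcons_cat; apply: letters_rcons_new.
have /negbTE kt : k \notin t by apply/negP => /lt_t; rewrite ltnn.
rewrite otherE kt sum_if_letter // /t /= -/(other_letters a v) -/d.
by rewrite !hornerE horner_comp !hornerE -[k.+1%:R%R]natr1.
Qed.

(** Downward induction on [d], starting from the zero sequence for [d >= m]. The terms with [d.+1]
    pass through multiplication by a polynomial and translation of the variable, both linear over
    [rat]. *)
Lemma C_finite_completions d : C_finite (completions_after_repeat^~ d).
Proof.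
have [e le_m] : exists e, m <= d + e by exists m; apply: leq_addl.
elim: e d le_m => [|e IHe] d le_m.
  apply: C_finite_ext (C_finite0 _) => L; rewrite addn0 in le_m.
  elim: L d le_m => [|L IHL] d le_m /=; first by rewrite ltnNge le_m.
  by rewrite -!IHL ?(leqW le_m) // scaler0 mulr0 comp_poly0 !addr0.
rewrite addnS -addSn in le_m; have CG := IHe _ le_m.
apply: (C_finite_rec (l := d.+1%:R%R) _ (fun L => erefl)).
apply: C_finite_add.
  by apply: C_finite_linear CG => l u v; rewrite mulrBr scalerAr.
by apply: C_finite_linear CG => l u v; rewrite comp_polyB comp_polyZ.
Qed.

(** While all letters are distinct, the next one is new, raising [k], or repeats one of the [k] old
    ones, with no other letter read since. The variable again stands for [k]. *)
Fixpoint completions_before_repeat (L : nat) : {poly rat} :=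
  if L is L'.+1 then
    ((completions_before_repeat L' \Po ('X + 1))
     + 'X * completions_after_repeat L' 0)%R
  else 1%R.

Lemma ext_count_before_repeat L k (w : seq nat) :
  uniq w -> (forall c, (c \in w) = (c < k)) ->
  ((ext_count (word_avoids pi) L k w)%:R = (completions_before_repeat L).[k%:R])%R.
Proof.
elim: L k w => [|L IHL] k w uniq_w w_letters /=.
  rewrite hornerC; suff -> : word_avoids pi w by [].
  by apply/(word_avoidsP _ setpart_pair_singletons)/uniq_avoids_pair_singletons.
rewrite natrD natr_sum (eq_bigr (fun=> (completions_after_repeat L 0).[k%:R])%R); last first.
  move=> c _; have wc : val c \in w by rewrite w_letters ltn_ord.
  rewrite -cats1 ext_count_after_repeat // cats1.
  exact: letters_rcons_old.
rewrite IHL; last first.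
- exact: letters_rcons_new.
- by rewrite rcons_uniq w_letters ltnn.
rewrite sumr_const card_ord -[X in (X + _)%R]mulr_natl addrC.
by rewrite !hornerE horner_comp !hornerE -[k.+1%:R%R]natr1.
Qed.

Lemma P_recursive_pair_singletons : P_recursive (num_avoid pi).
Proof.
apply: C_finite_P_recursive.
have CG : C_finite (fun L => 'X * completions_after_repeat L 0 : {poly rat})%R.
  by apply: C_finite_linear (C_finite_completions 0) => l u v; rewrite mulrBr scalerAr.
(* The count is the value at 0 because the empty word has no letters. *)
apply: C_finite_ext (C_finite_translation_rec CG (fun L => erefl)) => n /=.
rewrite num_avoid_ext_count ?setpart_pair_singletons //.
by rewrite ext_count_before_repeat.
Qed.
End PairSingletons.

(** * The pattern 12...m *)

Lemma subseq_nseq (T : eqType) m (x : T) (w : seq T) :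
  subseq (nseq m x) w = (m <= count_mem x w).
Proof.
apply/idP/idP => [/(leq_count_subseq (pred1 x))|le_m].
  by rewrite count_nseq /= eqxx mul1n.
apply: subseq_trans (filter_subseq (pred1 x) w).
have /all_pred1P -> : all (pred1 x) [seq y <- w | pred1 x y] by apply: filter_all.
rewrite size_filter -(subnKC le_m) nseqD.
exact: prefix_subseq.
Qed.

(** Label each element by its own block: the letter [B] then occurs [#|B|] times. *)
Lemma contains_oneblockP n m (sigma : {set {set 'I_n}}) : 0 < m -> is_setpart sigma ->
  reflect (exists2 B, B \in sigma & m <= #|B|) (contains sigma (oneblock_part m)).
Proof.
move=> m_gt0 Ps; have Ppi : is_setpart (oneblock_part m).
  by rewrite oneblock_partE //; apply: preim_partitionP.
have csP := containsP (lab := pblock sigma) Ps Ppi (fun i j => erefl).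
have countE B : B \in sigma -> count_mem B [seq pblock sigma i | i <- enum 'I_n] = #|B|.
  move=> sB; rewrite count_map cardE /= -size_filter; congr size.
  rewrite [in RHS]/enum_mem -enumT; apply: eq_filter => i /=.
  apply/eqP/idP => [<-|]; first exact: mem_pblock_setpart.
  exact: pblock_setpart.
apply: (iffP idP) => [/csP|[B sB le_m]].
  rewrite oneblock_partE // => /word_contains_preim[v sub_v ker_v].
  pose i0 := Ordinal m_gt0; pose B := tnth v i0.
  have sB : B \in sigma.
    have /(mem_subseq sub_v)/mapP[i _ ->] : B \in v by apply: mem_tnth.
    exact: pblock_in_setpart.
  exists B => //; rewrite -countE // -subseq_nseq.
  suff <- : v = nseq m B :> seq _ by [].
  apply/esym; rewrite -{1}(size_tuple v); apply/esym/all_pred1P/allP => _ /tnthP[i ->].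
  by rewrite /= /B -ker_v.
apply/csP; rewrite oneblock_partE //; apply/word_contains_preim.
exists [tuple of nseq m B]; first by rewrite /= subseq_nseq countE.
by move=> i j; rewrite !(tnth_nth B) /= !nth_nseq !if_same !eqxx.
Qed.

Section BoundedBlocks.
Variable m : nat.

(** The ground set is an arbitrary [A], so that removing a block leaves an object of the same
    kind. *)
Definition bounded_partitions (T : finType) (A : {set T}) : {set {set {set T}}} :=
  [set P | partition P A && [forall B in P, #|B| <= m]].

Lemma num_avoid_oneblock n :
  num_avoid (oneblock_part m.+1) n = #|bounded_partitions [set: 'I_n]|.
Proof.
congr #|pred_of_set _|; apply/setP=> P; rewrite !inE; apply: andb_id2l => PP.
have csP := contains_oneblockP (ltn0Sn m) PP.
apply/negP/forall_inP => [nc B sB|le_m /csP[B sB]]; last by rewrite ltnNge le_m.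
by rewrite leqNgt; apply/negP => lt_m; apply/nc/csP; exists B.
Qed.

(** Adding the block [B] is a bijection, with inverse its removal. *)
Lemma bounded_partitions_pblock (T : finType) (A B : {set T}) x :
  B \subset A -> x \in B -> #|B| <= m ->
  #|[set P in bounded_partitions A | pblock P x == B]| = #|bounded_partitions (A :\: B)|.
Proof.
move=> sBA xB le_m.
have notin P : partition P (A :\: B) -> B \notin P.
  move=> PP; apply/negP => /(partitionS PP)/subsetP/(_ x xB).
  by rewrite inE xB.
have inj : {in bounded_partitions (A :\: B) &, injective (fun P => B |: P)}.
  move=> P Q; rewrite !inE => /andP[/notin nP _] /andP[/notin nQ _] eqPQ.
  by rewrite -(setU1K nP) eqPQ setU1K.
rewrite -(card_in_imset inj); congr #|pred_of_set _|; apply/setP=> P; rewrite !inE.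
apply/andP/imsetP => [[/andP[PP /forall_inP boundP] /eqP PxB]|[Q]].
  have BP : B \in P.
    by rewrite -PxB pblock_mem // (cover_partition PP) (subsetP sBA).
  exists (P :\ B); last by rewrite setD1K.
  rewrite inE partitionD1 //; apply/forall_inP => C /setD1P[_]; exact: boundP.
rewrite inE => /andP[PQ /forall_inP boundQ ->].
have disj : [disjoint B & A :\: B] by rewrite -setI_eq0 setDE setICA setICr setI0.
have PU : partition (B |: Q) A.
  have -> : A = B :|: A :\: B by rewrite -{1}(setIidPr sBA) setID.
  by apply: partitionU1 => //; apply/set0Pn; exists x.
split; last by rewrite (def_pblock (partition_trivIset PU) (setU11 _ _) xB).
rewrite PU; apply/forall_inP => C /setU1P[-> //|]; exact: boundQ.
Qed.

Lemma card_draws_mem (T : finType) (A : {set T}) x j : x \in A ->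
  #|[set B : {set T} | [&& B \subset A, x \in B & #|B| == j.+1]]| = 'C(#|A|.-1, j).
Proof.
move=> xA; have -> : #|A|.-1 = #|A :\ x| by rewrite [in LHS](cardsD1 x) xA.
rewrite -cards_draws.
have inj : {in [set C : {set T} | C \subset A :\ x & #|C| == j] &,
    injective (fun C => x |: C)}.
  move=> C D; rewrite !inE !subsetD1 => /andP[/andP[_ xC] _] /andP[/andP[_ xD] _] eqCD.
  by rewrite -(setU1K xC) eqCD setU1K.
rewrite -(card_in_imset inj); congr #|pred_of_set _|; apply/setP=> B; rewrite !inE.
apply/and3P/imsetP => [[sBA xB /eqP cB]|[C]].
  exists (B :\ x); last by rewrite setD1K.
  by rewrite inE setSD //= -eqSS -cB (cardsD1 x B) xB.
rewrite inE subsetD1 => /andP[/andP[sCA xC] /eqP cC] ->.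
by rewrite setU11 cardsU1 xC cC subUset sub1set xA sCA.
Qed.

(** Partitions are sorted by the block of [x], then blocks by size [j.+1]. The function [f] stands
    for the count on smaller sets, so that the lemma applies inside the induction showing that
    counts depend only on cardinality. *)
Lemma card_bounded_partitions_rec (T : finType) (A : {set T}) (f : nat -> nat) x :
  x \in A ->
  (forall B : {set T}, x \in B -> #|bounded_partitions (A :\: B)| = f #|A :\: B|) ->
  #|bounded_partitions A| = \sum_(j < m) 'C(#|A|.-1, j) * f (#|A|.-1 - j).
Proof.
move=> xA fE.
pose Q (B : {set T}) := [&& B \subset A, x \in B & #|B| <= m].
rewrite -sum1_card (partition_big (pblock^~ x) Q) => [|P]; last first.
  rewrite inE => /andP[PP /forall_inP boundP]; have covP := cover_partition PP.
  have PxP : pblock P x \in P by rewrite pblock_mem ?covP.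
  by rewrite /Q (partitionS PP PxP) mem_pblock covP xA boundP.
transitivity (\sum_(B | Q B) f (#|A| - #|B|)).
  apply: eq_bigr => B /and3P[sBA xB le_m].
  have -> : #|A| - #|B| = #|A :\: B| by rewrite cardsD (setIidPr sBA).
  rewrite -fE // -(bounded_partitions_pblock sBA xB le_m) -sum1_card.
  by apply: eq_bigl => P; rewrite !inE.
(* Sizes are at most [m], so [inord] is faithful; size 0 is excluded by [x]. *)
rewrite (partition_big (fun B : {set T} => inord #|B| : 'I_m.+1) xpredT) //=.
rewrite big_ord_recl big1 ?add0n => [|B /andP[/and3P[_ xB le_m]]]; last first.
  by rewrite -val_eqE /= inordK ?ltnS // cards_eq0 => /eqP B0; rewrite B0 inE in xB.
apply: eq_bigr => j _.
have QjE (B : {set T}) : Q B && (inord #|B| == lift ord0 j) =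
    [&& B \subset A, x \in B & #|B| == j.+1].
  rewrite -!andbA; congr [&& _, _ & _]; apply/andP/eqP => [[le_m]|->].
    by rewrite -val_eqE /= inordK ?ltnS // => /eqP.
  by split; [exact: ltn_ord | rewrite -val_eqE /= inordK ?ltnS].
rewrite (eq_bigl _ _ QjE) (eq_bigr (fun=> f (#|A|.-1 - j))) => [|B /and3P[_ _ /eqP ->]]; last first.
  by congr f; lia.
rewrite sum_nat_const -(card_draws_mem j xA); congr (_ * _).
by apply: eq_card => B; rewrite inE.
Qed.

(** Sets of equal size obey the same recurrence, so strong induction replaces transport along a
    bijection. *)
Lemma card_bounded_partitions n (T : finType) (A : {set T}) :
  #|A| = n -> #|bounded_partitions A| = num_avoid (oneblock_part m.+1) n.
Proof.
elim/ltn_ind: n T A => n IHn T A cardA; rewrite num_avoid_oneblock.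
case: n IHn cardA => [|n] IHn cardA.
  have bp0 (S : finType) (B : {set S}) : #|B| = 0 -> bounded_partitions B = [set set0].
    move=> /eqP; rewrite cards_eq0 => /eqP ->; apply/setP=> P.
    rewrite !inE partition_set0; case: eqP => //= ->.
    by apply/forall_inP => C; rewrite inE.
  by rewrite !bp0 ?cards1 // cardsT card_ord.
have step (S : finType) (B : {set S}) : #|B| = n.+1 ->
    #|bounded_partitions B|
      = \sum_(j < m) 'C(n, j) * num_avoid (oneblock_part m.+1) (n - j).
  move=> cardB; have /card_gt0P[x xB] : 0 < #|B| by rewrite cardB.
  rewrite (card_bounded_partitions_rec (f := num_avoid (oneblock_part m.+1)) xB) ?cardB // => C xC.
  apply: IHn => //; rewrite -cardB; apply: proper_card.
  by apply/properP; split; [apply: subsetDl | exists x; rewrite // inE xC].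
by rewrite !step // cardsT card_ord.
Qed.

Lemma num_avoid_oneblock_rec n :
  num_avoid (oneblock_part m.+1) n.+1
    = \sum_(j < m) 'C(n, j) * num_avoid (oneblock_part m.+1) (n - j).
Proof.
rewrite num_avoid_oneblock.
pose a := num_avoid (oneblock_part m.+1).
rewrite (card_bounded_partitions_rec (f := a) (in_setT ord0)) => [|B _].
  by rewrite cardsT card_ord.
exact: card_bounded_partitions.
Qed.
End BoundedBlocks.

(** The binomial coefficient of ['X + m] over [j], as a falling factorial divided by [j!]. *)
Definition shifted_bin_poly (m j : nat) : {poly rat} :=
  ((j`!)%:R^-1 *: \prod_(l < j) ('X + (m - l)%:R%:P))%R.

(* [j <= m] makes the subtractions [m - l] above exact. *)
Lemma horner_shifted_bin_poly (m j n : nat) :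
  j <= m -> ((shifted_bin_poly m j).[n%:R] = ('C(n + m, j))%:R)%R.
Proof.
move=> le_jm.
have fact_neq0 : ((j`!)%:R != 0 :> rat)%R by rewrite Num.Theory.pnatr_eq0 -lt0n fact_gt0.
rewrite hornerZ horner_prod; apply: (canLR (mulKf fact_neq0)).
rewrite -natrM mulnC bin_ffact ffact_prod natr_prod; apply: eq_bigr => l _.
rewrite !hornerE -natrD; congr (_%:R)%R.
by rewrite addnBA // ltnW // (leq_trans (ltn_ord l)).
Qed.

Lemma P_recursive_oneblock m : 0 < m -> P_recursive (num_avoid (oneblock_part m)).
Proof.
case: m => // m _; pose a := num_avoid (oneblock_part m.+1).
(* The recurrence is taken at [n + m], so that every index [n + m - j] is at least [n]; the
   coefficient of [a (n + i)] comes from [j = m - i], and [i = 0] does not occur since [j < m]. *)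
pose P (i : nat) : {poly rat} :=
  if i == m.+1 then 1%R else if i == 0 then 0%R else (- shifted_bin_poly m (m - i))%R.
exists m.+1, (fun i => P i); split.
  by exists ord_max; rewrite /P eqxx oner_neq0.
move=> n; rewrite big_ord_recr big_ord_recl /= {1 3}/P /= eqxx horner0 mul0r add0r.
rewrite hornerC mul1r addnS num_avoid_oneblock_rec natr_sum.
rewrite [X in (_ + X)%R](reindex_inj rev_ord_inj) /= -big_split /=; apply: big1 => i _.
have lt_i := ltn_ord i.
rewrite /P /bump /= add1n eqSS (ltn_eqF lt_i) hornerN horner_shifted_bin_poly ?leq_subr //.
have -> : n + m - (m - i.+1) = n + i.+1 by lia.
by rewrite mulNr natrM addNr.
Qed.

(** * Patterns of size three *)

Section Patterns3.
Variable pi : {set {set 'I_3}}.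
Hypothesis Ppi : is_setpart pi.

Let i0 : 'I_3 := Ordinal (isT : 0 < 3).
Let i1 : 'I_3 := Ordinal (isT : 1 < 3).
Let i2 : 'I_3 := Ordinal (isT : 2 < 3).

Lemma ord3_ind (P : 'I_3 -> Prop) : P i0 -> P i1 -> P i2 -> forall i, P i.
Proof.
by move=> P0 P1 P2 -[[|[|[|//]]] lt_i]; rewrite (bool_irrelevance lt_i isT).
Qed.

Lemma setpart3_eq (rT : eqType) (f : 'I_3 -> rT) :
  (pblock pi i0 == pblock pi i1) = (f i0 == f i1) ->
  (pblock pi i1 == pblock pi i2) = (f i1 == f i2) ->
  (pblock pi i0 == pblock pi i2) = (f i0 == f i2) ->
  pi = preim_partition f [set: 'I_3].
Proof.
move=> e01 e12 e02; apply: preim_partition_eq => //.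
by apply: ord3_ind; apply: ord3_ind; rewrite ?eqxx // eq_sym [RHS]eq_sym.
Qed.

Lemma word_contains3 (T : eqType) (w : seq T) :
  word_contains pi w <->
  exists x y z, [/\ subseq [:: x; y; z] w, (pblock pi i0 == pblock pi i1) = (x == y),
    (pblock pi i1 == pblock pi i2) = (y == z) & (pblock pi i0 == pblock pi i2) = (x == z)].
Proof.
split=> [[v sub_v ker_v]|[x [y [z [sub_v e01 e12 e02]]]]].
  case: v sub_v ker_v => -[|x [|y [|z [|? ?]]]] //= size_v sub_v ker_v.
  by exists x, y, z; split; rewrite // (ker_v i0 i1, ker_v i1 i2, ker_v i0 i2).
exists [tuple x; y; z] => //; apply: ord3_ind; apply: ord3_ind; rewrite ?eqxx //.
- by rewrite eq_sym [RHS]eq_sym.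
- by rewrite eq_sym [RHS]eq_sym.
- by rewrite eq_sym [RHS]eq_sym.
Qed.

(** * The pattern 13/2: weakly increasing words *)

Section P13_2.
Hypotheses (e01 : (pblock pi i0 == pblock pi i1) = false)
           (e02 : (pblock pi i0 == pblock pi i2) = true).

Lemma sorted_avoids_13_2 (w : seq nat) : sorted leq w -> ~ word_contains pi w.
Proof.
move=> sorted_w /word_contains3[x [y [z []]]].
move=> /subseq_sorted/(_ sorted_w)-/(_ leq_trans) /=.
rewrite e01 e02 => /and3P[le_xy le_yz _] ne_xy _ /esym/eqP eq_xz.
by rewrite -eq_xz in le_yz; rewrite eqn_leq le_xy le_yz in ne_xy.
Qed.

(** After the largest letter [k], a smaller [c] would create [c k c]; the only choices are [k] and
    [k.+1], two at each step. *)
Lemma ext_count_13_2 L k (w : seq nat) :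
  sorted leq (rcons w k) -> (forall c, (c \in rcons w k) = (c < k.+1)) ->
  ext_count (word_avoids pi) L k.+1 (rcons w k) = 2 ^ L.
Proof.
elim: L k w => [|L IHL] k w sorted_w w_letters /=.
  by rewrite (introT (word_avoidsP _ Ppi) (sorted_avoids_13_2 sorted_w)).
have e12 : (pblock pi i1 == pblock pi i2) = false.
  by rewrite -(eqP e02) eq_sym.
have sorted_rcons d : k <= d -> sorted leq (rcons (rcons w k) d).
  move=> le_kd; case: (w) sorted_w => [|x u] /= path_u; first by rewrite le_kd.
  by rewrite rcons_path path_u last_rcons.
rewrite big_ord_recr /= big1 ?add0n => [|c _].
  rewrite !IHL ?sorted_rcons // ?addnn ?expnS ?mul2n //.
    exact: letters_rcons_new.
  by apply: letters_rcons_old => //; apply: ltnSn.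
apply: ext_count_contains => //; apply/word_contains3; exists (val c), k, (val c).
have ne_ck : (val c == k) = false := ltn_eqF (ltn_ord c).
rewrite e01 e02 e12 ne_ck eqxx [k == _]eq_sym ne_ck; split=> //.
rewrite -[rcons (rcons _ _) _]cats1 -[rcons w k]cats1 -!catA.
have wc : val c \in w.
  by have := w_letters (val c); rewrite mem_rcons inE ne_ck ltnW ?ltnS ?ltn_ord.
rewrite -[[:: val c; _; _]]/([:: val c] ++ [:: k; val c]).
by apply: cat_subseq; rewrite ?sub1seq.
Qed.

Lemma P_recursive_13_2 : P_recursive (num_avoid pi).
Proof.
apply/C_finite_P_recursive/C_finite_behead.
apply: C_finite_ext (C_finite_rec (l := 2%:R%R) (C_finite0 _)
   (a := fun n => (2 ^ n)%:R%R : rat^o) _) => n.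
  rewrite num_avoid_ext_count //= big_ord0 add0n.
  by rewrite (@ext_count_13_2 n 0 [::]) // => -[].
by rewrite addr0 expnS natrM.
Qed.
End P13_2.

(** * The pattern 1/23: an initial run of zeros, then almost distinct letters *)

Section P1_23.
Hypotheses (e01 : (pblock pi i0 == pblock pi i1) = false)
           (e12 : (pblock pi i1 == pblock pi i2) = true).

Let e02 : (pblock pi i0 == pblock pi i2) = false.
Proof. by rewrite -(eqP e12). Qed.

Lemma avoids_1_23 i (u : seq nat) : uniq u -> ~ word_contains pi (nseq i 0 ++ u).
Proof.
move=> uniq_u /word_contains3[x [y [z []]]]; rewrite e01 e12.
move=> /subseq_cat_split[s1 [s2 [eq_s sub1 sub2]]] ne_xy /esym/eqP eq_yz _.
case: s1 eq_s sub1 => [|x' [|y' s1]] /= eq_s sub1.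
- by move: (subseq_uniq sub2 uniq_u); rewrite -eq_s eq_yz /= !inE eqxx andbF.
- by case: eq_s sub2 => _ <- /subseq_uniq/(_ uniq_u); rewrite eq_yz /= inE eqxx.
case: eq_s ne_xy => -> -> _; have := mem_subseq sub1.
by move=> sub; have := sub x'; have := sub y'; rewrite !inE !eqxx !orbT !mem_nseq;
  move=> /(_ isT)/andP[_ /eqP->] /(_ isT)/andP[_ /eqP->].
Qed.

Lemma contains_1_23_rcons (w u : seq nat) c :
  c \in u -> (exists2 a, a \in w & a != c) -> word_contains pi (rcons (w ++ u) c).
Proof.
move=> uc [a wa /negbTE ne_ac]; apply/word_contains3; exists a, c, c.
rewrite e01 e12 e02 eqxx ne_ac; split=> //.
rewrite -cats1 -catA -[[:: a; c; c]]/([:: a] ++ [:: c] ++ [:: c]).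
by apply: cat_subseq; rewrite ?subseq_cat2r sub1seq.
Qed.

(** Repeating a nonzero letter [c] creates [0 c c], and a second 0 after [x] creates [x 0 0]. So the
    [L] further letters are all new except for at most one 0, in one of [L] places. *)
Lemma ext_count_1_23_after L k i x (u : seq nat) :
  uniq (x :: u) -> x != 0 -> (forall c, (c \in nseq i.+1 0 ++ x :: u) = (c < k)) ->
  ext_count (word_avoids pi) L k (nseq i.+1 0 ++ x :: u) = if 0 \in u then 1 else L.+1.
Proof.
elim: L k u => [|L IHL] k u uniq_u ne_x0 w_letters.
  by rewrite ext_count0 (introT (word_avoidsP _ Ppi) (avoids_1_23 uniq_u)) if_same.
have rcons_w c : rcons (nseq i.+1 0 ++ x :: u) c = nseq i.+1 0 ++ x :: rcons u c.
  by rewrite rcons_cat.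
have : 0 < k by rewrite -w_letters.
case: k w_letters => // k w_letters _.
have new_k : k.+1 \notin x :: u.
  apply/negP => uk; have := w_letters k.+1; rewrite ltnn mem_cat uk orbT //.
rewrite ext_countS big_ord_recl [X in _ + X + _]big1 => [|c _]; last first.
  apply: ext_count_contains => //; apply: contains_1_23_rcons; last by exists 0.
  have := w_letters c.+1; rewrite mem_cat ltnS ltn_ord mem_nseq.
  by case/orP => // /andP[].
have new_letters := letters_rcons_new w_letters.
have new_uniq : uniq (x :: rcons u k.+1) by rewrite -rcons_cons rcons_uniq new_k.
rewrite addn0 !rcons_w; rewrite rcons_w in new_letters; rewrite [in X in _ + X]IHL //.
have -> : (0 \in rcons u k.+1) = (0 \in u) by rewrite mem_rcons inE.
rewrite [nat_of_ord ord0]/=; case: ifP => u0.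
  rewrite -rcons_w ext_count_contains //.
  rewrite -cat1s catA; apply: contains_1_23_rcons => //; exists x => //.
  by rewrite mem_cat mem_seq1 eqxx orbT.
have := letters_rcons_old w_letters (ltn0Sn k); rewrite rcons_w => old_letters.
rewrite IHL //; first by rewrite mem_rcons inE eqxx.
by rewrite -rcons_cons rcons_uniq uniq_u inE u0 eq_sym (negbTE ne_x0).
Qed.

(** Either the run of zeros goes on, or it stops with the letter 1 and the preceding count applies;
    Pascal's rule sums up. *)
Lemma ext_count_1_23 L i :
  ext_count (word_avoids pi) L 1 (nseq i.+1 0) = 'C(L.+1, 2).+1.
Proof.
elim: L i => [|L IHL] i.
  by rewrite ext_count0 -[nseq _ _]cats0 (introT (word_avoidsP _ Ppi) (@avoids_1_23 i.+1 [::] _)).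
have -> : ext_count (word_avoids pi) L.+1 1 (nseq i.+1 0) =
  ext_count (word_avoids pi) L 1 (rcons (nseq i.+1 0) 0) +
  ext_count (word_avoids pi) L 2 (rcons (nseq i.+1 0) 1) by rewrite ext_countS big_ord1.
have -> : rcons (nseq i.+1 0) 0 = nseq i.+2 0.
  by rewrite -cats1 -[[:: 0]]/(nseq 1 0) -nseqD addn1.
rewrite IHL -cats1 ext_count_1_23_after //=; last first.
  by move=> c; rewrite inE mem_cat mem_nseq inE; case: c => [|[|c]]; rewrite ?andbF ?orbT.
by rewrite [in RHS]binS bin1 addSn.
Qed.

Lemma P_recursive_1_23 : P_recursive (num_avoid pi).
Proof.
apply/C_finite_P_recursive/C_finite_behead.
apply: C_finite_ext (C_finite_rec (l := 1%R) (C_finite_horner ('X + 1))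
   (a := fun n => ('C(n.+1, 2).+1)%:R%R : rat^o) _) => n.
  rewrite num_avoid_ext_count //= big_ord0 add0n.
  by rewrite (ext_count_1_23 n 0).
have -> : (('X + 1 : {poly rat}).[n%:R] = n.+1%:R)%R by rewrite !hornerE natr1.
rewrite scale1r -natrD addSn.
by rewrite [in LHS]binS bin1.
Qed.
End P1_23.

(** Of the eight outcomes of the three equality tests, three violate transitivity and the others are
    the five partitions. *)
Lemma P_recursive_setpart3 :
  P_recursive (num_avoid (singletons_part 3)) ->
  P_recursive (num_avoid (oneblock_part 3)) ->
  P_recursive (num_avoid (pair_singletons_part 3)) ->
  P_recursive (num_avoid pi).
Proof.
rewrite (singletons_partE 3) (@oneblock_partE 3) // (@pair_singletons_partE 3) //.
move=> P1 P2 P3.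
case e01: (pblock pi i0 == pblock pi i1); case e12: (pblock pi i1 == pblock pi i2);
  case e02: (pblock pi i0 == pblock pi i2).
- by rewrite (@setpart3_eq _ (fun=> tt)).
- by move/eqP: e01 e02 => ->; rewrite e12.
- by move/eqP: e01 e12 => <-; rewrite e02.
- by rewrite (@setpart3_eq _ (fun i : 'I_3 => maxn 1 i)).
- by move/eqP: e02 e01 => ->; rewrite eq_sym e12.
- exact: P_recursive_1_23.
- exact: P_recursive_13_2.
- by rewrite (@setpart3_eq _ id).
Qed.
End Patterns3.

Theorem theorem3p7 :
  (forall m : nat, (1 <= m)%N ->
     P_recursive (num_avoid (singletons_part m)) /\
     P_recursive (num_avoid (oneblock_part m))) /\
  (forall m : nat, (2 <= m)%N -> P_recursive (num_avoid (pair_singletons_part m))) /\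
  (forall pi : {set {set 'I_3}}, is_setpart pi -> P_recursive (num_avoid pi)).
Proof.
split=> [m m_gt0|]; first by split; [apply: P_recursive_singletons | apply: P_recursive_oneblock].
split=> [[|[|m]] // _|pi Ppi]; first exact: P_recursive_pair_singletons.
apply: P_recursive_setpart3 => //.
- exact: P_recursive_singletons.
- exact: P_recursive_oneblock.
- exact: (P_recursive_pair_singletons 1).
Qed.
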